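(* Let $A\in\mathbb R_+^{n\times n}$, $B\in\mathbb R^{n\times m}$, $E\in\mathbb R_+^{m\times n}$, $s\in\mathbb R^n_+$, $r\in\mathbb R^m$, $\gamma\in\mathbb R^n_+$ with $A\ge|B|E$ and $s\ge E^\top|r|$, and consider the model class $\mathcal M=\{(A,B),(A,-B)\}$. Let $K_+,K_-\in\mathcal K(E)$. Suppose there exist vectors $p_+,p_-,h\in\mathbb R^n$ satisfying $0\le\max\{p_+,p_-\}\le h\le\gamma$ such that the following inequalities hold: (i) $p_\sigma\ge s+K_\sigma^\top r+(A+\sigma BK_\sigma)^\top p_\sigma$ for all $\sigma\in\{+,-\}$; (ii) $h\ge s+K_k^\top r+(A+\sigma BK_k)^\top p_\sigma$ for all $k,\sigma\in\{+,-\}$ with $k\ne\sigma$; (iii) $h^\top x\ge(s^\top+r^\top K_k+h^\top A)x+(h-\gamma)^\top|BK_kx|$ for $k\in\{+,-\}$ and all $x\in\mathbb R_+^n$. Then the Bellman inequality $\mathcal F\,\overline V(x,Z)\le\overline V(x,Z)$ holds for $$\overline V(x,Z)=\max\Bigl\{p_+^\top x-z^{(+)},\ p_-^\top x-z^{(-)},\ h^\top x-\tfrac12\bigl(z^{(+)}+z^{(-)}\bigr)\Bigr\}.$$ Consequently, the certainty equivalence policy $$u_t=K_{k_t}x_t,\qquad k_t=\arg\min_{\sigma\in\{+,-\}}z_t^{(\sigma)},$$ satisfies the cost bound $J_\mu(x_0)\le h^\top x_0$. If, in addition, $m=1$ (the single input case), then inequality (iii) simplifies to the state independent inequality (iii')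 $h^\top\ge s^\top+r^\top K_k+h^\top A+(h-\gamma)^\top|B|E$, $\quad k\in\{+,-\}$.
   Context: Inequalities, maxima and absolute values of vectors and matrices are elementwise; $\mathbb R^n_+$ is the nonnegative orthant; $\mathbb N$ includes $0$. In matrix expressions $\sigma\in\{+,-\}$ acts as $\pm1$. $\mathcal K(E):=\{K\in\mathbb R^{m\times n}:K=\Lambda E,\ \Lambda=\mathrm{diag}(\lambda_1,\dots,\lambda_m),\ \lambda_i\in[-1,1]\}$ and $\mathcal U(x):=\{u\in\mathbb R^m:|u|\le Ex\}$ for $x\in\mathbb R_+^n$. For a pair of real numbers $Z=\{z^{(+)},z^{(-)}\}$ and a function $V(x,Z)$, the operator $\mathcal F$ is $$\mathcal FV(x,Z):=\min_{u\in\mathcal U(x)}\max_{v\ge0}\bigl\{s^\top x+r^\top u+V(v,Z_+)\bigr\},$$ where $v\in\mathbb R^n_+$, $Z_+=\{z_+^{(+)},z_+^{(-)}\}$ and $z_+^{(\sigma)}=z^{(\sigma)}+\gamma^\top|v-Ax-\sigma Bu|$. The Bellman inequality is meant for all $x\in\mathbb R^n_+$ and all $Z$. Along a trajectory, the histories are $z_0^{(\sigma)}=0$, $z_{t+1}^{(\sigma)}=z_t^{(\sigma)}+\gamma^\top|x_{t+1}-Ax_t-\sigma Bu_t|$ for $\sigma\in\{+,-\}$; they are computable from past states and inputs, so the policy above is causal. The cost of a causal policy $\mu$ (with $u_t=\mu_t(x_0,\dots,x_t;u_0,\dots,u_{t-1})\in\mathcal U(x_t)$) from $x_0\in\mathbb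 R_+^n$ is $$J_\mu(x_0)=\sup_{(\hat A,\hat B)\in\mathcal M,\ w,\ T\in\mathbb N}\ \sum_{t=0}^T\bigl(s^\top x_t+r^\top u_t-\gamma^\top|w_t|\bigr),$$ subject to $x_{t+1}=\hat Ax_t+\hat Bu_t+w_t$, where the supremum is over disturbance sequences with $w_t\ge-(\hat Ax_t+\hat Bu_t)$ for all $t$.
   Formalization: Assumes p_+ ≥ 0 and p_- ≥ 0 separately (only max{p_+,p_-} ≥ 0 makes the claims false). For m=1, (iii') ⇒ (iii) fails in general, so shown instead: (iii) ⇒ (iii'), equivalence if |K_k| = E, and equivalence of (iii) to (iii') with |BK_k| replacing |B|E. *)

(* Defs.v *)
From mathcomp Require Import all_boot all_order all_algebra.
From mathcomp Require Import all_classical all_reals ereal.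

Set Implicit Arguments.
Unset Strict Implicit.
Unset Printing Implicit Defensive.

Import Order.TTheory GRing.Theory Num.Theory.

Local Open Scope classical_set_scope.
Local Open Scope ring_scope.

Definition mx_le (R : realType) (a b : nat) (M N : 'M[R]_(a, b)) : Prop :=
  forall i j, M i j <= N i j.

Notation "M <=mx N" := (mx_le M N) (at level 70, no associativity) : ring_scope.

(* Entrywise, unlike the norm that `|M| denotes on normed matrix spaces. *)
Definition mx_abs (R : realType) (a b : nat) (M : 'M[R]_(a, b)) : 'M[R]_(a, b) :=
  map_mx (fun y => `|y|) M.

Definition mx_max (R : realType) (a b : nat) (M N : 'M[R]_(a, b)) : 'M[R]_(a, b) :=
  \matrix_(i, j) Num.max (M i j) (N i j).

Definition dot (R : realType) (a : nat) (c x : 'cV[R]_a) : R :=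
  (c^T *m x) ord0 ord0.

(* The signs {+, -} are the booleans, with true standing for +.  A pair
   Z = {z^(+), z^(-)} of reals is a function bool -> R. *)
Definition pm (R : realType) (sigma : bool) : R := if sigma then 1 else - 1.
Arguments pm {R} sigma.

Definition gain_set (R : realType) (n m : nat) (E : 'M[R]_(m, n)) :
    set 'M[R]_(m, n) :=
  [set K | exists2 lam : 'rV[R]_m,
     forall i, - 1 <= lam ord0 i <= 1 & K = diag_mx lam *m E].

Definition input_set (R : realType) (n m : nat) (E : 'M[R]_(m, n))
    (x : 'cV[R]_n) : set 'cV[R]_m :=
  [set u | mx_abs u <=mx E *m x].

Definition hist_next (R : realType) (n m : nat) (A : 'M[R]_n)
    (B : 'M[R]_(n, m)) (gamma : 'cV[R]_n) (x : 'cV[R]_n) (u : 'cV[R]_m)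
    (v : 'cV[R]_n) (Z : bool -> R) : bool -> R :=
  fun sigma => Z sigma + dot gamma (mx_abs (v - A *m x - pm sigma *: (B *m u))).

Definition stage_value (R : realType) (n m : nat) (A : 'M[R]_n)
    (B : 'M[R]_(n, m)) (s : 'cV[R]_n) (r : 'cV[R]_m) (gamma : 'cV[R]_n)
    (V : 'cV[R]_n -> (bool -> R) -> R)
    (x : 'cV[R]_n) (Z : bool -> R) (u : 'cV[R]_m) (v : 'cV[R]_n) : R :=
  dot s x + dot r u + V v (hist_next A B gamma x u v Z).

Definition worst_value (R : realType) (n m : nat) (A : 'M[R]_n)
    (B : 'M[R]_(n, m)) (s : 'cV[R]_n) (r : 'cV[R]_m) (gamma : 'cV[R]_n)
    (V : 'cV[R]_n -> (bool -> R) -> R)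
    (x : 'cV[R]_n) (Z : bool -> R) (u : 'cV[R]_m) : \bar R :=
  ereal_sup [set (stage_value A B s r gamma V x Z u v)%:E |
             v in [set v : 'cV[R]_n | 0 <=mx v]].

(* For an arbitrary V the minimum and the maximum need not be attained, so the
   operator is an infimum of suprema in \bar R; bellman_attained says that it
   is a genuine min max at (x, Z). *)
Definition bellman_op (R : realType) (n m : nat) (A : 'M[R]_n)
    (B : 'M[R]_(n, m)) (E : 'M[R]_(m, n)) (s : 'cV[R]_n) (r : 'cV[R]_m)
    (gamma : 'cV[R]_n) (V : 'cV[R]_n -> (bool -> R) -> R)
    (x : 'cV[R]_n) (Z : bool -> R) : \bar R :=
  ereal_inf [set worst_value A B s r gamma V x Z u | u in input_set E x].

Definition bellman_attained (R : realType) (n m : nat) (A : 'M[R]_n)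
    (B : 'M[R]_(n, m)) (E : 'M[R]_(m, n)) (s : 'cV[R]_n) (r : 'cV[R]_m)
    (gamma : 'cV[R]_n) (V : 'cV[R]_n -> (bool -> R) -> R)
    (x : 'cV[R]_n) (Z : bool -> R) : Prop :=
  (forall u, input_set E x u ->
     exists2 v : 'cV[R]_n, 0 <=mx v &
       (stage_value A B s r gamma V x Z u v)%:E
         = worst_value A B s r gamma V x Z u)
  /\ (exists2 u, input_set E x u &
       worst_value A B s r gamma V x Z u = bellman_op A B E s r gamma V x Z).

Definition Vbar (R : realType) (n : nat) (p : bool -> 'cV[R]_n) (h : 'cV[R]_n)
    (x : 'cV[R]_n) (Z : bool -> R) : R :=
  Num.max (Num.max (dot (p true) x - Z true) (dot (p false) x - Z false))
          (dot h x - 2^-1 * (Z true + Z false)).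

(* The input at time t is a function of (x_0, ..., x_t) and
   (u_0, ..., u_(t-1)), which makes every policy causal by construction. *)
Definition policy (R : realType) (n m : nat) : Type :=
  forall t : nat, ('I_t.+1 -> 'cV[R]_n) -> ('I_t -> 'cV[R]_m) -> 'cV[R]_m.

Definition policy_at (R : realType) (n m : nat) (mu : policy R n m)
    (x : nat -> 'cV[R]_n) (u : nat -> 'cV[R]_m) (t : nat) : 'cV[R]_m :=
  mu t (fun i => x (nat_of_ord i)) (fun i => u (nat_of_ord i)).

Definition admissible_policy (R : realType) (n m : nat) (E : 'M[R]_(m, n))
    (mu : policy R n m) : Prop :=
  forall (x : nat -> 'cV[R]_n) (u : nat -> 'cV[R]_m) (t : nat),
    0 <=mx x t -> input_set E (x t) (policy_at mu x u t).

Definition model_class (R : realType) (n m : nat) (A : 'M[R]_n)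
    (B : 'M[R]_(n, m)) : set ('M[R]_n * 'M[R]_(n, m)) :=
  [set (A, B); (A, - B)].

Definition closed_loop (R : realType) (n m : nat)
    (M : 'M[R]_n * 'M[R]_(n, m)) (mu : policy R n m) (x0 : 'cV[R]_n)
    (w x : nat -> 'cV[R]_n) (u : nat -> 'cV[R]_m) : Prop :=
  [/\ x 0%N = x0,
      forall t, u t = policy_at mu x u t
    & forall t, x t.+1 = M.1 *m x t + M.2 *m u t + w t].

Definition cost (R : realType) (n m : nat) (A : 'M[R]_n) (B : 'M[R]_(n, m))
    (s : 'cV[R]_n) (r : 'cV[R]_m) (gamma : 'cV[R]_n) (mu : policy R n m)
    (x0 : 'cV[R]_n) : \bar R :=
  ereal_sup [set c : \bar R |
    exists (M : 'M[R]_n * 'M[R]_(n, m)) (w x : nat -> 'cV[R]_n)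
           (u : nat -> 'cV[R]_m) (T : nat),
      [/\ model_class A B M,
          closed_loop M mu x0 w x u,
          forall t, - (M.1 *m x t + M.2 *m u t) <=mx w t
        & c = (\sum_(0 <= t < T.+1)
                 (dot s (x t) + dot r (u t) - dot gamma (mx_abs (w t))))%:E]].

Fixpoint hist (R : realType) (n m : nat) (A : 'M[R]_n) (B : 'M[R]_(n, m))
    (gamma : 'cV[R]_n) (x : nat -> 'cV[R]_n) (u : nat -> 'cV[R]_m) (t : nat) :
    bool -> R :=
  if t is t'.+1
  then hist_next A B gamma (x t') (u t') (x t'.+1) (hist A B gamma x u t')
  else fun=> 0.

(* Ties in the argmin may be broken arbitrarily, so this is a predicate.
   Every finite history extends to a pair of sequences, and hist at time t only
   depends on x_0, ..., x_t and u_0, ..., u_(t-1). *)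
Definition certainty_equivalence (R : realType) (n m : nat) (A : 'M[R]_n)
    (B : 'M[R]_(n, m)) (gamma : 'cV[R]_n) (K : bool -> 'M[R]_(m, n))
    (mu : policy R n m) : Prop :=
  forall (x : nat -> 'cV[R]_n) (u : nat -> 'cV[R]_m) (t : nat),
    exists2 k : bool,
      forall sigma, hist A B gamma x u t k <= hist A B gamma x u t sigma
    & policy_at mu x u t = K k *m x t.

Definition h_condition (R : realType) (n m : nat) (A : 'M[R]_n)
    (B : 'M[R]_(n, m)) (s : 'cV[R]_n) (r : 'cV[R]_m) (gamma h : 'cV[R]_n)
    (Kk : 'M[R]_(m, n)) : Prop :=
  forall x : 'cV[R]_n, 0 <=mx x ->
    (s^T + r^T *m Kk + h^T *m A) *m x + (h - gamma)^T *m mx_abs (B *m Kk *m x)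
      <=mx h^T *m x.

(* With N = |B| E or N = |B K_k|, the state-independent forms of h_condition. *)
Definition h_condition_linear (R : realType) (n m : nat) (A : 'M[R]_n)
    (s : 'cV[R]_n) (r : 'cV[R]_m) (gamma h : 'cV[R]_n)
    (Kk : 'M[R]_(m, n)) (N : 'M[R]_n) : Prop :=
  s^T + r^T *m Kk + h^T *m A + (h - gamma)^T *m N <=mx h^T.

(* Main.v *)
Require Import Defs.
From mathcomp Require Import all_boot all_order all_algebra.
From mathcomp Require Import all_classical all_reals ereal.
From mathcomp Require Import topology normedtype derive.
From mathcomp Require Import lra.

Set Implicit Arguments.
Unset Strict Implicit.
Unset Printing Implicit Defensive.

Import Order.TTheory GRing.Theory Num.Theory.
Import numFieldNormedType.Exports.

Local Open Scope classical_set_scope.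
Local Open Scope ring_scope.

(** Why the bound holds.  Write a = A x, b = B u; z^(sigma) is the disturbance
    penalty the adversary has paid so far if the true model is
    (A, sigma B).  Against an input u the adversary picks the next state v, and
    each of the three branches of Vbar, evaluated after the move, is a concave
    piecewise linear function of v whose peak can be located by hand.  The
    p_sigma branch trades p_sigma v against gamma |v - a - sigma b|; since
    0 <= p_sigma <= gamma, deviating from the nominal successor never pays, and
    the peak is v = a + sigma b ([dot_peak]).  The h branch is charged with the
    average of both penalties; since 0 <= h <= gamma, entry by entry it does
    not decrease up to the larger of the two nominal successors and does not
    increase beyond it, so its peak is v = a + |b| ([dot_two_peaks]).  All three peaks are nonnegative
    because |b| <= |B| E x <= A x.  Hence the inner maximum is attained, and its
    value is the explicit function [worst_stage] of u ([worst_valueE]).  That function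
    is continuous and the inputs form a box, which gives the outer minimum
    ([bellman_min_max_attained]).

    The Bellman inequality then needs only one good input, u = K_k x with k the
    better fitting model.  The three branches of [worst_stage] are bounded as
    follows ([certainty_equivalence_decrease]): the branch of the model k by
    its own branch of Vbar through (i); the branch of the other model by the h
    branch through (ii), because z^(other) is at least the average of the
    penalties; and the h branch by itself through (iii).

    For the cost bound, the inequality is summed along a closed loop trajectory
    ([value_telescope]).  If the true model is (A, sigma B), then z^(sigma) is
    exactly the accumulated penalty of w ([hist_disturbance]), and it is
    recovered from the final value since Vbar >= p_sigma x - z^(sigma).  The
    initial value is max (p_+ x_0, p_- x_0, h x_0) = h x_0.

    With a single input, K = lambda E for a scalar lambda, so B K x has entries
    of the form (B_i lambda) (E x), where E x >= 0, and the absolute value in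
    (iii) is linear in x on the orthant ([h_condition_single_input]). *)

(** * Entrywise order and the pairing of vectors *)

Lemma dotE (R : realType) (a : nat) (c x : 'cV[R]_a) :
  dot c x = \sum_i c i ord0 * x i ord0.
Proof. by rewrite /dot mxE; apply: eq_bigr => i _; rewrite mxE. Qed.

Lemma dotDr (R : realType) (a : nat) (c x y : 'cV[R]_a) :
  dot c (x + y) = dot c x + dot c y.
Proof. by rewrite /dot mulmxDr mxE. Qed.

Lemma dotBr (R : realType) (a : nat) (c x y : 'cV[R]_a) :
  dot c (x - y) = dot c x - dot c y.
Proof. by rewrite /dot mulmxBr !mxE. Qed.

Lemma dotZr (R : realType) (a : nat) (k : R) (c x : 'cV[R]_a) :
  dot c (k *: x) = k * dot c x.
Proof. by rewrite /dot -scalemxAr mxE. Qed.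

Lemma dotDl (R : realType) (a : nat) (c d x : 'cV[R]_a) :
  dot (c + d) x = dot c x + dot d x.
Proof. by rewrite /dot raddfD mulmxDl mxE. Qed.

Lemma dotBl (R : realType) (a : nat) (c d x : 'cV[R]_a) :
  dot (c - d) x = dot c x - dot d x.
Proof. by rewrite /dot raddfB mulmxBl !mxE. Qed.

Lemma dot_adj (R : realType) (a b : nat) (M : 'M[R]_(a, b))
    (c : 'cV[R]_a) (x : 'cV[R]_b) :
  dot (M^T *m c) x = dot c (M *m x).
Proof. by rewrite /dot trmx_mul trmxK mulmxA. Qed.

Lemma ler_dotr (R : realType) (a : nat) (c x y : 'cV[R]_a) :
  0 <=mx c -> x <=mx y -> dot c x <= dot c y.
Proof.
move=> c0 xy; rewrite !dotE; apply: ler_sum => i _; apply: ler_wpM2l => //.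
by have := c0 i ord0; rewrite mxE.
Qed.

Lemma ler_dotl (R : realType) (a : nat) (c d x : 'cV[R]_a) :
  0 <=mx x -> c <=mx d -> dot c x <= dot d x.
Proof.
move=> x0 cd; rewrite !dotE; apply: ler_sum => i _; apply: ler_wpM2r => //.
by have := x0 i ord0; rewrite mxE.
Qed.

Lemma dot_ge0 (R : realType) (a : nat) (c x : 'cV[R]_a) :
  0 <=mx c -> 0 <=mx x -> 0 <= dot c x.
Proof.
by move=> c0 x0; apply: le_trans (ler_dotr c0 x0); rewrite /dot mulmx0 mxE.
Qed.

Lemma mx_abs_ge0 (R : realType) (a b : nat) (M : 'M[R]_(a, b)) :
  0 <=mx mx_abs M.
Proof. by move=> i j; rewrite !mxE. Qed.

Lemma mulmx_ge0 (R : realType) (a b c : nat) (M : 'M[R]_(a, b))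
    (N : 'M[R]_(b, c)) :
  0 <=mx M -> 0 <=mx N -> 0 <=mx M *m N.
Proof.
move=> M0 N0 i j; rewrite !mxE sumr_ge0 // => k _; apply: mulr_ge0.
  by have := M0 i k; rewrite mxE.
by have := N0 k j; rewrite mxE.
Qed.

Lemma ler_mulmxr (R : realType) (a b c : nat) (M : 'M[R]_(a, b))
    (N P : 'M[R]_(b, c)) :
  0 <=mx M -> N <=mx P -> M *m N <=mx M *m P.
Proof.
move=> M0 NP i j; rewrite !mxE ler_sum // => k _; apply: ler_wpM2l => //.
by have := M0 i k; rewrite mxE.
Qed.

Lemma ler_mulmxl (R : realType) (a b c : nat) (M N : 'M[R]_(a, b))
    (P : 'M[R]_(b, c)) :
  0 <=mx P -> M <=mx N -> M *m P <=mx N *m P.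
Proof.
move=> P0 MN i j; rewrite !mxE ler_sum // => k _; apply: ler_wpM2r => //.
by have := P0 k j; rewrite mxE.
Qed.

Lemma mx_abs_mul (R : realType) (a b c : nat) (M : 'M[R]_(a, b))
    (N : 'M[R]_(b, c)) :
  mx_abs (M *m N) <=mx mx_abs M *m mx_abs N.
Proof.
move=> i j; rewrite !mxE; apply: le_trans (ler_norm_sum _ _ _) _.
by apply: ler_sum => k _; rewrite normrM !mxE.
Qed.

Lemma mx_le_trans (R : realType) (a b : nat) (M N P : 'M[R]_(a, b)) :
  M <=mx N -> N <=mx P -> M <=mx P.
Proof. by move=> MN NP i j; apply: le_trans (MN i j) (NP i j). Qed.

(** * Admissible inputs *)

Lemma gain_abs_le (R : realType) (n m : nat) (E K : 'M[R]_(m, n)) :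
  0 <=mx E -> gain_set E K -> mx_abs K <=mx E.
Proof.
move=> E0 [lam lam1 ->] i j; have := E0 i j.
rewrite mul_diag_mx !mxE => Eij; rewrite normrM (ger0_norm Eij).
by rewrite ler_piMl // ler_norml lam1.
Qed.

Lemma gain_input (R : realType) (n m : nat) (E K : 'M[R]_(m, n))
    (x : 'cV[R]_n) :
  0 <=mx E -> gain_set E K -> 0 <=mx x -> input_set E x (K *m x).
Proof.
move=> E0 KE x0; apply: mx_le_trans (mx_abs_mul _ _) _.
have -> : mx_abs x = x.
  apply/matrixP => i j; rewrite mxE ger0_norm //.
  by have := x0 i j; rewrite mxE.
exact/ler_mulmxl/gain_abs_le.
Qed.

(** The hypothesis |B| E <= A bounds the influence of the input by the drift,
    which keeps the nominal successors in the orthant. *)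
Lemma input_gain_bound (R : realType) (n m : nat) (A : 'M[R]_n)
    (B : 'M[R]_(n, m)) (E : 'M[R]_(m, n)) (x : 'cV[R]_n) (u : 'cV[R]_m) :
  mx_abs B *m E <=mx A -> 0 <=mx x -> input_set E x u ->
  mx_abs (B *m u) <=mx A *m x.
Proof.
move=> BEA x0 uEx; apply: mx_le_trans (mx_abs_mul _ _) _.
apply: mx_le_trans (ler_mulmxl x0 BEA); rewrite -mulmxA.
exact/ler_mulmxr/uEx/mx_abs_ge0.
Qed.

Lemma nominal_next_ge0 (R : realType) (n m : nat) (A : 'M[R]_n)
    (B : 'M[R]_(n, m)) (E : 'M[R]_(m, n)) (x : 'cV[R]_n) (u : 'cV[R]_m)
    (sigma : bool) :
  mx_abs B *m E <=mx A -> 0 <=mx x -> input_set E x u ->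
  0 <=mx A *m x + pm sigma *: (B *m u).
Proof.
move=> BEA x0 uEx i j; have := input_gain_bound BEA x0 uEx i j.
by rewrite !mxE ler_norml /pm; case: sigma => /andP[? ?]; lra.
Qed.

(** * The adversary's best reply *)

(** Moving away from the peak gains at most c |d|, which the penalty g >= c
    outweighs. *)
Lemma dot_peak (R : realType) (a : nat) (c g d : 'cV[R]_a) :
  0 <=mx c -> c <=mx g -> dot c d - dot g (mx_abs d) <= 0.
Proof.
move=> c0 cg; rewrite subr_le0.
apply: le_trans (ler_dotl (mx_abs_ge0 d) cg); apply: ler_dotr => // i j.
by rewrite mxE ler_norm.
Qed.

(** Entry by entry, |d - b| + |d + b| = 2 M with M = max (|d|, |b|), so the left
    side is c d - g M <= (c - g) M, and c - g <= 0 while M >= |b|. *)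
Lemma dot_two_peaks (R : realType) (a : nat) (c g d b : 'cV[R]_a) :
  0 <=mx c -> c <=mx g ->
  dot c d - 2^-1 * (dot g (mx_abs (d - b)) + dot g (mx_abs (d + b)))
    <= dot (c - g) (mx_abs b).
Proof.
move=> c0 cg; rewrite !dotE -big_split mulr_sumr -sumrB; apply: ler_sum => i _.
have := c0 i ord0; have := cg i ord0; rewrite !mxE /=.
set ci := c i _; set gi := g i _; set di := d i _; set bi := b i _ => cgi ci0.
rewrite -mulrDr.
have : 2 * Num.max `|di| `|bi| <= `|di - bi| + `|di + bi|.
  have := ler_norm (di - bi); have := ler_norm (di + bi).
  have := lerNnormlW (lexx `|di - bi|); have := lerNnormlW (lexx `|di + bi|).
  rewrite /Num.max; case: ltP => _.
    by case: (ger0P bi) => _ ; lra.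
  by case: (ger0P di) => _ ; lra.
set M := Num.max _ _ => hM.
have dM : di <= M by rewrite /M le_max ler_norm.
have bM : `|bi| <= M by rewrite /M le_max lexx orbT.
have : gi * (2 * M) <= gi * (`|di - bi| + `|di + bi|).
  by apply: ler_wpM2l => //; lra.
have : ci * di <= ci * M by apply: ler_wpM2l.
have : (gi - ci) * `|bi| <= (gi - ci) * M by apply: ler_wpM2l; lra.
by lra.
Qed.

(** The branches of the value after the adversary has moved to the peak of each
    branch.  At v = A x + pm sigma B u the penalty of model sigma vanishes; at
    v = A x + |B u| the two penalties average to gamma |B u|, which merges with
    the gain h |B u|. *)
Definition worst_stage (R : realType) (n m : nat) (A : 'M[R]_n)
    (B : 'M[R]_(n, m)) (s : 'cV[R]_n) (r : 'cV[R]_m) (gamma : 'cV[R]_n)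
    (p : bool -> 'cV[R]_n) (h : 'cV[R]_n) (x : 'cV[R]_n) (Z : bool -> R)
    (u : 'cV[R]_m) : R :=
  dot s x + dot r u +
  Num.max (Num.max (dot (p true) (A *m x + pm true *: (B *m u)) - Z true)
                   (dot (p false) (A *m x + pm false *: (B *m u)) - Z false))
          (dot h (A *m x) + dot (h - gamma) (mx_abs (B *m u))
             - 2^-1 * (Z true + Z false)).

(** Each branch lies below its own peak value, so the maximum of the branches
    lies below the maximum of the peaks. *)
Lemma stage_value_le_worst (R : realType) (n m : nat) (A : 'M[R]_n)
    (B : 'M[R]_(n, m)) (s : 'cV[R]_n) (r : 'cV[R]_m) (gamma : 'cV[R]_n)
    (p : bool -> 'cV[R]_n) (h : 'cV[R]_n) (x : 'cV[R]_n) (Z : bool -> R)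
    (u : 'cV[R]_m) (v : 'cV[R]_n) :
  (forall sigma, 0 <=mx p sigma) -> (forall sigma, p sigma <=mx gamma) ->
  0 <=mx h -> h <=mx gamma ->
  stage_value A B s r gamma (Vbar p h) x Z u v
    <= worst_stage A B s r gamma p h x Z u.
Proof.
move=> p0 pg h0 hg; rewrite /stage_value /worst_stage lerD2l /Vbar /hist_next.
have peak sigma : dot (p sigma) v
    - (Z sigma + dot gamma (mx_abs (v - A *m x - pm sigma *: (B *m u))))
    <= dot (p sigma) (A *m x + pm sigma *: (B *m u)) - Z sigma.
  have := dot_peak (v - A *m x - pm sigma *: (B *m u)) (p0 sigma) (pg sigma).
  by rewrite !dotBr dotDr; lra.
have avg := dot_two_peaks (v - A *m x) (B *m u) h0 hg.
rewrite !ge_max !le_max !peak ?orbT /=; apply/orP; right.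
move: avg; rewrite /= scale1r scaleN1r opprK dotBr; lra.
Qed.

(** The reply depends on which branch of [worst_stage] is the largest: after the
    move to the peak of that branch, the branch alone reaches the bound. *)
Lemma worst_stage_attained (R : realType) (n m : nat) (A : 'M[R]_n)
    (B : 'M[R]_(n, m)) (E : 'M[R]_(m, n)) (s : 'cV[R]_n) (r : 'cV[R]_m)
    (gamma : 'cV[R]_n) (p : bool -> 'cV[R]_n) (h : 'cV[R]_n)
    (x : 'cV[R]_n) (Z : bool -> R) (u : 'cV[R]_m) :
  mx_abs B *m E <=mx A -> 0 <=mx x -> input_set E x u ->
  exists2 v : 'cV[R]_n, 0 <=mx v &
    worst_stage A B s r gamma p h x Z u
      <= stage_value A B s r gamma (Vbar p h) x Z u v.
Proof.
move=> BEA x0 uEx.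
have hit sigma :
    hist_next A B gamma x u (A *m x + pm sigma *: (B *m u)) Z sigma = Z sigma.
  rewrite /hist_next [X in X - _ - _]addrC addrK subrr.
  by rewrite dotE big1 ?addr0 // => i _; rewrite !mxE normr0 mulr0.
rewrite /worst_stage /stage_value.
case: leP => [_|_]; last case: leP => [_|_].
- exists (A *m x + mx_abs (B *m u)).
    have Ax0 : 0 <=mx A *m x.
      exact: mx_le_trans (mx_abs_ge0 _) (input_gain_bound BEA x0 uEx).
    move=> i j; rewrite mxE [in leRHS]mxE addr_ge0 //.
      by have := Ax0 i j; rewrite mxE.
    by have := mx_abs_ge0 (B *m u) i j; rewrite mxE.
  rewrite lerD2l /Vbar le_max; apply/orP; right.
  rewrite /hist_next /= scale1r scaleN1r opprK [X in X - A *m x]addrC addrK.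
  (* entrywise, one of |b| - b and |b| + b is zero and the other is 2 |b| *)
  have -> : dot (h - gamma) (mx_abs (B *m u)) = dot h (mx_abs (B *m u))
      - 2^-1 * (dot gamma (mx_abs (mx_abs (B *m u) - B *m u))
                + dot gamma (mx_abs (mx_abs (B *m u) + B *m u))).
    rewrite dotBl !dotE -big_split mulr_sumr; congr (_ - _).
    apply: eq_bigr => i _; rewrite !mxE /=.
    move: (\sum_j _) (gamma i _) => b g.
    have [b0|b0] := ger0P b.
      by rewrite subrr normr0 (ger0_norm (addr_ge0 b0 b0)); lra.
    by rewrite addNr normr0 ger0_norm; lra.
  by rewrite dotDr; lra.
- exists (A *m x + pm false *: (B *m u)); first exact: nominal_next_ge0 uEx.
  by rewrite lerD2l /Vbar hit !le_max lexx !orbT.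
- exists (A *m x + pm true *: (B *m u)); first exact: nominal_next_ge0 uEx.
  by rewrite lerD2l /Vbar hit !le_max lexx.
Qed.

Lemma worst_valueE (R : realType) (n m : nat) (A : 'M[R]_n)
    (B : 'M[R]_(n, m)) (E : 'M[R]_(m, n)) (s : 'cV[R]_n) (r : 'cV[R]_m)
    (gamma : 'cV[R]_n) (p : bool -> 'cV[R]_n) (h : 'cV[R]_n)
    (x : 'cV[R]_n) (Z : bool -> R) (u : 'cV[R]_m) :
  (forall sigma, 0 <=mx p sigma) -> (forall sigma, p sigma <=mx gamma) ->
  0 <=mx h -> h <=mx gamma ->
  mx_abs B *m E <=mx A -> 0 <=mx x -> input_set E x u ->
  worst_value A B s r gamma (Vbar p h) x Z u
    = (worst_stage A B s r gamma p h x Z u)%:E.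
Proof.
move=> p0 pg h0 hg BEA x0 uEx.
have [v v0 Wv] := worst_stage_attained s r gamma p h Z BEA x0 uEx.
apply/eqP; rewrite eq_le; apply/andP; split.
  by apply: ge_ereal_sup => _ [w _ <-]; rewrite lee_fin stage_value_le_worst.
apply: ereal_sup_ge; exists (stage_value A B s r gamma (Vbar p h) x Z u v)%:E.
  by exists v.
by rewrite lee_fin.
Qed.

(** * The minimum over the inputs *)

(** The extreme value theorem, applied to row vectors, where the box is a
    product of segments. *)
Lemma cV_box_min (R : realType) (m : nat) (c : 'cV[R]_m)
    (f : 'cV[R]_m -> R) :
  0 <=mx c -> continuous f ->
  exists2 u, mx_abs u <=mx c & forall w, mx_abs w <=mx c -> f u <= f w.
Proof.
move=> c0 fcont.
pose box := [set v : 'rV[R]_m |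
  forall i, `[- c i ord0, c i ord0]%classic (v ord0 i)].
have boxP (v : 'cV[R]_m) : mx_abs v <=mx c <-> box v^T.
  split=> [vc i|vb i j]; rewrite /= ?in_itv /=.
    by have := vc i ord0; rewrite !mxE ler_norml.
  by have := vb i; rewrite /= in_itv /= !mxE (ord1 j) ler_norml.
have box0 : box !=set0.
  exists 0^T; apply/boxP => i j; rewrite !mxE normr0.
  by have := c0 i j; rewrite mxE.
have boxK : compact box.
  apply: (@rV_compact R m (fun i => `[- c i ord0, c i ord0]%classic)) => i.
  exact: segment_compact.
have trcont : continuous (fun v : 'rV[R]_m => v^T).
  move=> v S /= /nbhs_ballP[e e0 eS].
  apply/nbhs_ballP; exists e => // w [_ vw].
  by apply: eS; split=> // i j; rewrite !mxE; exact: vw.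
have [u ub umin] := compact_EVT_min box0 boxK
   (continuous_subspaceT (fun v => continuous_comp (trcont v) (fcont _))).
exists u^T; first by apply/boxP; rewrite trmxK; exact: set_mem ub.
by move=> w /boxP wb; have := umin _ (mem_set wb); rewrite /= trmxK.
Qed.

Lemma dot_continuous (R : realType) (a : nat) (c : 'cV[R]_a) :
  continuous (dot c).
Proof.
move=> x; rewrite (_ : dot c = fun y => \sum_i c i ord0 * y i ord0).
  apply: (continuous_big (op := +%R) (x0 := 0)) => [|i _ y].
    exact: add_continuous.
  apply: (continuousM (s := fun=> c i ord0)
                      (t := fun z : 'cV[R]_a => z i ord0)).
    exact: cst_continuous.
  exact: coord_continuous.
by apply/funext => y; rewrite dotE.
Qed.

Lemma dot_mx_abs_continuous (R : realType) (a b : nat) (c : 'cV[R]_a)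
    (M : 'M[R]_(a, b)) :
  continuous (fun u : 'cV[R]_b => dot c (mx_abs (M *m u))).
Proof.
move=> x; rewrite (_ : (fun u => _) =
    fun u => \sum_i c i ord0 * `|dot (row i M)^T u|).
  apply: (continuous_big (op := +%R) (x0 := 0)) => [|i _ y].
    exact: add_continuous.
  apply: (continuousM (s := fun=> c i ord0)
                      (t := fun u => `|dot (row i M)^T u|)).
    exact: cst_continuous.
  exact: (cvg_norm (@dot_continuous _ _ (row i M)^T y)).
apply/funext => u; rewrite dotE; apply: eq_bigr => i _.
by rewrite [mx_abs _ _ _]mxE /dot trmxK -row_mul [row _ _ _ _]mxE.
Qed.

Lemma worst_stage_continuous (R : realType) (n m : nat) (A : 'M[R]_n)
    (B : 'M[R]_(n, m)) (s : 'cV[R]_n) (r : 'cV[R]_m) (gamma : 'cV[R]_n)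
    (p : bool -> 'cV[R]_n) (h : 'cV[R]_n) (x : 'cV[R]_n) (Z : bool -> R) :
  continuous (worst_stage A B s r gamma p h x Z).
Proof.
have cst (c : R) : continuous (fun _ : 'cV[R]_m => c) by exact: cst_continuous.
have add (f g : 'cV[R]_m -> R) : continuous f -> continuous g ->
    continuous (fun u => f u + g u).
  by move=> fc gc u; exact: continuousD (fc u) (gc u).
have maxc (f g : 'cV[R]_m -> R) : continuous f -> continuous g ->
    continuous (fun u => Num.max (f u) (g u)).
  by move=> fc gc u; exact: continuous_max (fc u) (gc u).
have branch sigma : continuous (fun u : 'cV[R]_m =>
    dot (p sigma) (A *m x + pm sigma *: (B *m u))).
  rewrite (_ : (fun w => _) = fun w => dot (p sigma) (A *m x)
      + dot (pm sigma *: (B^T *m p sigma)) w).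
    by apply: add; [exact: cst|exact: dot_continuous].
  apply/funext => w; rewrite dotDr dotZr; congr (_ + _).
  by rewrite -dot_adj /dot linearZ -scalemxAl [RHS]mxE.
rewrite /worst_stage; apply: (add).
  by apply: (add); [exact: cst|exact: dot_continuous].
apply: (maxc).
  by apply: (maxc); apply: (add); first [exact: branch|exact: cst].
apply: (add); last exact: cst.
by apply: (add); [exact: cst|exact: dot_mx_abs_continuous].
Qed.

Lemma bellman_min_max_attained (R : realType) (n m : nat) (A : 'M[R]_n)
    (B : 'M[R]_(n, m)) (E : 'M[R]_(m, n)) (s : 'cV[R]_n) (r : 'cV[R]_m)
    (gamma : 'cV[R]_n) (p : bool -> 'cV[R]_n) (h : 'cV[R]_n)
    (x : 'cV[R]_n) (Z : bool -> R) :
  (forall sigma, 0 <=mx p sigma) -> (forall sigma, p sigma <=mx gamma) ->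
  0 <=mx h -> h <=mx gamma ->
  0 <=mx E -> mx_abs B *m E <=mx A -> 0 <=mx x ->
  bellman_attained A B E s r gamma (Vbar p h) x Z.
Proof.
move=> p0 pg h0 hg E0 BEA x0.
have worstE u (uEx : input_set E x u) :=
  worst_valueE s r Z p0 pg h0 hg BEA x0 uEx.
split=> [u uEx|].
  have [v v0 Wv] := worst_stage_attained s r gamma p h Z BEA x0 uEx.
  exists v => //; rewrite worstE //; congr _%:E.
  by apply/eqP; rewrite eq_le Wv stage_value_le_worst.
have [u uEx umin] := cV_box_min (mulmx_ge0 E0 x0)
  (@worst_stage_continuous _ _ _ A B s r gamma p h x Z).
exists u => //; apply/eqP; rewrite eq_le; apply/andP; split.
  apply: le_ereal_inf_tmp => _ [w wEx <-].
  by rewrite !worstE // lee_fin; exact: umin.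
apply: ge_ereal_inf; exists (worst_value A B s r gamma (Vbar p h) x Z u) => //.
by exists u.
Qed.

(** * The Bellman inequality under the certainty equivalence input *)

(** The index k fits best, so z^(k) <= z^(~~ k), hence z^(~~ k) is at least the
    average (z^(+) + z^(-)) / 2.  This is what lets (ii) bound the branch of the
    model ~~ k by the h branch. *)
Lemma certainty_equivalence_decrease (R : realType) (n m : nat) (A : 'M[R]_n)
    (B : 'M[R]_(n, m)) (s : 'cV[R]_n) (r : 'cV[R]_m) (gamma : 'cV[R]_n)
    (K : bool -> 'M[R]_(m, n)) (p : bool -> 'cV[R]_n) (h : 'cV[R]_n)
    (x : 'cV[R]_n) (Z : bool -> R) (k : bool) :
  (forall sigma : bool,
      s + (K sigma)^T *m r + (A + pm sigma *: (B *m K sigma))^T *m p sigma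
        <=mx p sigma) ->
  (forall k sigma : bool, k != sigma ->
      s + (K k)^T *m r + (A + pm sigma *: (B *m K k))^T *m p sigma <=mx h) ->
  h_condition A B s r gamma h (K k) ->
  0 <=mx x -> (forall sigma, Z k <= Z sigma) ->
  worst_stage A B s r gamma p h x Z (K k *m x) <= Vbar p h x Z.
Proof.
move=> dec_same dec_cross dec_avg x0 kmin.
have applied sigma q :
    s + (K k)^T *m r + (A + pm sigma *: (B *m K k))^T *m p sigma <=mx q ->
    dot s x + dot r (K k *m x)
      + dot (p sigma) (A *m x + pm sigma *: (B *m (K k *m x))) <= dot q x.
  move=> /(ler_dotl x0); rewrite !dotDl !dot_adj.
  by rewrite mulmxDl -scalemxAl !mulmxA.
have same := applied k _ (dec_same k).
have cross := applied (~~ k) _ (dec_cross k (~~ k) _).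
have avg : dot s x + dot r (K k *m x) + dot h (A *m x)
    + dot (h - gamma) (mx_abs (B *m (K k *m x))) <= dot h x.
  have := dec_avg x x0 ord0 ord0.
  by rewrite !mulmxDl mxE [X in X + _]mxE [X in X + _ + _]mxE -!mulmxA.
have {cross} : dot s x + dot r (K k *m x)
      + dot (p (~~ k)) (A *m x + pm (~~ k) *: (B *m (K k *m x))) <= dot h x.
  by apply: cross; case: (k).
have := kmin (~~ k); move: same avg.
case: (k) => /= same avg zk cross.
all: rewrite /worst_stage /Vbar -lerBrDl !ge_max !lerBrDl !le_max.
- apply/andP; split; first (apply/andP; split).
  + by rewrite addrA lerD2r same.
  + by apply/orP; right; lra.
  + by apply/orP; right; lra.
- apply/andP; split; first (apply/andP; split).
  + by apply/orP; right; lra.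
  + by rewrite addrA lerD2r same orbT.
  + by apply/orP; right; lra.
Qed.

(** * The single input case *)

(** One input channel makes B K a matrix of rank one whose entries
    B_i lambda E_l have, in each row, the constant sign of B_i lambda.  So
    |B K x| = |B K| x on the orthant, and an affine inequality on the orthant is
    equivalent to its instances at the basis vectors. *)
Lemma h_condition_single_input (R : realType) (n : nat) (A : 'M[R]_n)
    (B : 'M[R]_(n, 1)) (E : 'M[R]_(1, n)) (s : 'cV[R]_n) (r : 'cV[R]_1)
    (gamma h : 'cV[R]_n) (K : 'M[R]_(1, n)) :
  0 <=mx E -> gain_set E K ->
  h_condition A B s r gamma h K <->
    h_condition_linear A s r gamma h K (mx_abs (B *m K)).
Proof.
move=> E0 [lam lam1 KE].
have absBK (x : 'cV[R]_n) : 0 <=mx x ->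
    mx_abs (B *m K *m x) = mx_abs (B *m K) *m x.
  move=> x0; apply/matrixP => i j.
  have entry l : (B *m K) i l = B i ord0 * lam ord0 ord0 * E ord0 l.
    by rewrite KE mxE big_ord1 mul_diag_mx mxE mulrA.
  have E_l l : 0 <= E ord0 l by have := E0 ord0 l; rewrite mxE.
  have x_l l : 0 <= x l j by have := x0 l j; rewrite mxE.
  have Ex_ge0 : 0 <= \sum_l E ord0 l * x l j.
    by apply: sumr_ge0 => l _; rewrite mulr_ge0.
  rewrite mxE mxE [RHS]mxE; under eq_bigr => l _ do rewrite entry -mulrA.
  rewrite -mulr_sumr normrM (ger0_norm Ex_ge0) mulr_sumr.
  apply: eq_bigr => l _.
  by rewrite mxE entry [in RHS]normrM (ger0_norm (E_l l)) mulrA.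
rewrite /h_condition /h_condition_linear; split=> [hK i j|hK x x0].
  have unit_ge0 : 0 <=mx (delta_mx j ord0 : 'cV[R]_n).
    by move=> a b; rewrite !mxE ler0n.
  have := hK _ unit_ge0 ord0 ord0.
  by rewrite absBK // mulmxA -mulmxDl -!colE !mxE (ord1 i).
rewrite absBK // mulmxA -mulmxDl; exact: ler_mulmxl.
Qed.

(** * The cost along closed loop trajectories *)

Lemma certainty_equivalence_admissible (R : realType) (n m : nat)
    (A : 'M[R]_n) (B : 'M[R]_(n, m)) (E : 'M[R]_(m, n)) (gamma : 'cV[R]_n)
    (K : bool -> 'M[R]_(m, n)) (mu : policy R n m) :
  0 <=mx E -> (forall k, gain_set E (K k)) ->
  certainty_equivalence A B gamma K mu -> admissible_policy E mu.
Proof.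
move=> E0 KE ce x u t xt0; have [k _ ->] := ce x u t.
exact: gain_input.
Qed.

(** The constraint on the disturbance says exactly that the next state is
    nonnegative. *)
Lemma closed_loop_ge0 (R : realType) (n m : nat)
    (M : 'M[R]_n * 'M[R]_(n, m)) (mu : policy R n m) (x0 : 'cV[R]_n)
    (w x : nat -> 'cV[R]_n) (u : nat -> 'cV[R]_m) :
  0 <=mx x0 -> closed_loop M mu x0 w x u ->
  (forall t, - (M.1 *m x t + M.2 *m u t) <=mx w t) ->
  forall t, 0 <=mx x t.
Proof.
move=> x00 [xE _ step] w_ge [|t]; first by rewrite xE.
move=> i j; rewrite step; have := w_ge t i j.
by rewrite !mxE; lra.
Qed.

(** Under the true model the residual x_(t+1) - A x_t - sigma B u_t is w_t. *)
Lemma hist_disturbance (R : realType) (n m : nat) (A : 'M[R]_n)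
    (B : 'M[R]_(n, m)) (gamma : 'cV[R]_n) (sigma : bool) (mu : policy R n m)
    (x0 : 'cV[R]_n) (w x : nat -> 'cV[R]_n) (u : nat -> 'cV[R]_m) :
  closed_loop (A, pm sigma *: B) mu x0 w x u ->
  forall t, hist A B gamma x u t sigma
    = \sum_(0 <= i < t) dot gamma (mx_abs (w i)).
Proof.
move=> [_ _ step]; elim=> [|t IHt]; first by rewrite big_nil.
have cancel (a b c : 'cV[R]_n) : a + b + c - a - b = c.
  by rewrite [X in X - _ - _]addrC -addrA -opprD addrK.
by rewrite big_nat_recr //= -IHt /hist_next step /= scalemxAl cancel.
Qed.

Lemma value_telescope (R : realType) (n m : nat) (A : 'M[R]_n)
    (B : 'M[R]_(n, m)) (s : 'cV[R]_n) (r : 'cV[R]_m) (gamma : 'cV[R]_n)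
    (V : 'cV[R]_n -> (bool -> R) -> R) (x : nat -> 'cV[R]_n)
    (u : nat -> 'cV[R]_m) :
  (forall t, stage_value A B s r gamma V (x t) (hist A B gamma x u t) (u t)
      (x t.+1) <= V (x t) (hist A B gamma x u t)) ->
  forall t, \sum_(0 <= i < t) (dot s (x i) + dot r (u i))
    + V (x t) (hist A B gamma x u t) <= V (x 0%N) (fun=> 0).
Proof.
move=> dec; elim=> [|t IHt]; first by rewrite big_nil add0r.
rewrite big_nat_recr //= -addrA; apply: le_trans IHt; rewrite lerD2l.
exact: dec.
Qed.

(** * Bellman inequality, cost bound and single input case *)

Theorem theorem2 (R : realType) (n m : nat)
    (A : 'M[R]_n) (B : 'M[R]_(n, m)) (E : 'M[R]_(m, n))
    (s : 'cV[R]_n) (r : 'cV[R]_m) (gamma : 'cV[R]_n)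
    (A_ge0 : 0 <=mx A) (E_ge0 : 0 <=mx E)
    (s_ge0 : 0 <=mx s) (gamma_ge0 : 0 <=mx gamma)
    (A_dom : mx_abs B *m E <=mx A) (s_dom : E^T *m mx_abs r <=mx s)
    (K : bool -> 'M[R]_(m, n)) (K_gain : forall k, gain_set E (K k))
    (p : bool -> 'cV[R]_n) (h : 'cV[R]_n)
    (p_ge0 : forall sigma, 0 <=mx p sigma)
    (p_le_h : mx_max (p true) (p false) <=mx h)
    (h_le_gamma : h <=mx gamma) :
  ((forall sigma : bool,
      s + (K sigma)^T *m r + (A + pm sigma *: (B *m K sigma))^T *m p sigma
        <=mx p sigma) ->
   (forall k sigma : bool, k != sigma ->
      s + (K k)^T *m r + (A + pm sigma *: (B *m K k))^T *m p sigma <=mx h) ->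
   (forall k : bool, h_condition A B s r gamma h (K k)) ->
   (forall (x : 'cV[R]_n) (Z : bool -> R), 0 <=mx x ->
      bellman_attained A B E s r gamma (Vbar p h) x Z /\
      (bellman_op A B E s r gamma (Vbar p h) x Z <= (Vbar p h x Z)%:E)%E) /\
   (forall mu : policy R n m, certainty_equivalence A B gamma K mu ->
      admissible_policy E mu /\
      (forall x0 : 'cV[R]_n, 0 <=mx x0 ->
         (cost A B s r gamma mu x0 <= (dot h x0)%:E)%E))) /\
  (m = 1%N -> forall k : bool,
     [/\ h_condition A B s r gamma h (K k) ->
           h_condition_linear A s r gamma h (K k) (mx_abs B *m E),
         mx_abs (K k) = E ->
           (h_condition A B s r gamma h (K k) <->
            h_condition_linear A s r gamma h (K k) (mx_abs B *m E))
       & h_condition A B s r gamma h (K k) <->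
           h_condition_linear A s r gamma h (K k) (mx_abs (B *m K k))]).
Proof.
have p_le sigma : p sigma <=mx h.
  move=> i j; have := p_le_h i j; rewrite mxE ge_max => /andP[pt pf].
  by case: sigma.
have p_le_gamma sigma : p sigma <=mx gamma by exact: mx_le_trans h_le_gamma.
have h_ge0 : 0 <=mx h by exact: mx_le_trans (p_le true).
split=> [dec_same dec_cross dec_avg|m1 k].
  have decrease x Z k : 0 <=mx x -> (forall sigma, Z k <= Z sigma) ->
      worst_stage A B s r gamma p h x Z (K k *m x) <= Vbar p h x Z.
    by move=> x0 kmin; exact: certainty_equivalence_decrease.
  split=> [x Z x0|mu ce].
    split; first exact: bellman_min_max_attained.
    pose k := Z true <= Z false.
    have kmin sigma : Z k <= Z sigma.
      rewrite /k; case: (leP (Z true) (Z false)) => [?|/ltW ?]; by case: sigma.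
    have KxEx := gain_input E_ge0 (K_gain k) x0.
    apply: ge_ereal_inf.
    exists (worst_value A B s r gamma (Vbar p h) x Z (K k *m x)).
      by exists (K k *m x).
    by rewrite (worst_valueE (E := E)) // lee_fin decrease.
  split=> [|x0 x00]; first exact: certainty_equivalence_admissible ce.
  apply: ge_ereal_sup => _ [M [w [x [u [T [MAB cl w_ge ->]]]]]].
  rewrite lee_fin; have x_ge0 := closed_loop_ge0 x00 cl w_ge.
  have [sigma Msigma] : exists sigma, M = (A, pm sigma *: B).
    case: MAB => ->; first by exists true; rewrite scale1r.
    by exists false; rewrite scaleN1r.
  rewrite {}Msigma in cl.
  rewrite sumrB -(hist_disturbance gamma cl).
  case: cl => x_init u_mu _.
  have := @value_telescope _ _ _ A B s r gamma (Vbar p h) x u _ T.+1.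
  have step t : stage_value A B s r gamma (Vbar p h) (x t)
      (hist A B gamma x u t) (u t) (x t.+1)
      <= Vbar p h (x t) (hist A B gamma x u t).
    apply: le_trans (stage_value_le_worst A B s r (x t) _ (u t) (x t.+1)
                       p_ge0 p_le_gamma h_ge0 h_le_gamma) _.
    by have [k kmin uk] := ce x u t; rewrite u_mu uk; exact: decrease.
  move=> /(_ step); have : Vbar p h (x 0%N) (fun=> 0) <= dot h x0.
    by rewrite x_init /Vbar !ge_max !subr0 addr0 mulr0 subr0 !ler_dotl ?lexx.
  have : - hist A B gamma x u T.+1 sigma
      <= Vbar p h (x T.+1) (hist A B gamma x u T.+1).
    apply: (@le_trans _ _ (dot (p sigma) (x T.+1)
                           - hist A B gamma x u T.+1 sigma)).
      by rewrite lerDr dot_ge0.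
    by rewrite /Vbar !le_max; case: (sigma); rewrite lexx ?orbT.
  by lra.
subst m.
have hlin := h_condition_single_input A B s r gamma h E_ge0 (K_gain k).
split=> //.
  (* |B K| <= |B| E, and h - gamma <= 0 reverses the inequality *)
  move=> /hlin; apply: mx_le_trans => i j.
  rewrite [leLHS]mxE [leRHS]mxE lerD2l !mxE; apply: ler_sum => l _.
  apply: ler_wnM2l.
    by have := h_le_gamma l ord0; rewrite !mxE (ord1 i); lra.
  apply: le_trans (mx_abs_mul B (K k) l j) _.
  exact: (ler_mulmxr (mx_abs_ge0 B) (gain_abs_le E_ge0 (K_gain k))).
have absBK : mx_abs (B *m K k) = mx_abs B *m mx_abs (K k).
  by apply/matrixP => i j; rewrite !mxE !big_ord1 normrM !mxE.
by move=> KE; rewrite -KE -absBK.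
Qed.
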